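(* Let $\Phi\subseteq\{I,O,U,\mathit{Self},Q_n,N_n\mid n\in\mathbb N\setminus\{0\}\}$ and let $\mathcal I$ and $\mathcal I'$ be fuzzy interpretations that are witnessed and modally saturated w.r.t. $\mathcal L'^{\triangle}_\Phi$. Let $Z:\Delta^{\mathcal I}\times\Delta^{\mathcal I'}\to\{0,1\}$ be defined by $Z(x,x')=1$ if $C^{\mathcal I}(x)=C^{\mathcal I'}(x')$ for all concepts $C$ of $\mathcal L'^{\triangle}_\Phi$, and $Z(x,x')=0$ otherwise. Then $Z$ is a crisp $\Phi$-bisimulation between $\mathcal I$ and $\mathcal I'$, and $Z'\le Z$ pointwise for every crisp $\Phi$-bisimulation $Z'$ between $\mathcal I$ and $\mathcal I'$ (i.e. $Z$ is the greatest one).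
   Context: Gödel operations on $[0,1]$: $p\otimes q=\min\{p,q\}$, $p\oplus q=\max\{p,q\}$, $\ominus p=1$ if $p=0$ and $0$ otherwise, $(p\Rightarrow q)=1$ if $p\le q$ and $q$ otherwise, $(p\Leftrightarrow q)=(p\Rightarrow q)\otimes(q\Rightarrow p)$. Fix pairwise disjoint sets $\mathsf{CN}$, $\mathsf{RN}$, $\mathsf{IN}$ of concept, role and individual names. A basic role w.r.t. $\Phi$ is $r\in\mathsf{RN}$, or $r^-$ when $I\in\Phi$. Roles and concepts of $\mathcal L^{\sim}_\Phi$: each $r\in\mathsf{RN}$ is a role; if $R,S$ are roles and $C$ a concept then $R\circ S$, $R\sqcup S$, $R^*$, $C?$ are roles; $R^-$ if $I\in\Phi$; $U$ if $U\in\Phi$; concepts: $p\in[0,1]$, $A\in\mathsf{CN}$, $C\sqcap D$, $C\to D$, $\neg C$, $C\sqcup D$, $\mathord{\sim}C$, $\forall R.C$, $\exists R.C$; $\{a\}$ if $O\in\Phi$; $\exists r.\mathit{Self}$ if $\mathit{Self}\in\Phi$; ${\ge}n\,R.C$, ${<}n\,R.C$ for basic $R$ if $Q_n\in\Phi$; ${\ge}n\,R$, ${<}n\,R$ for basic $R$ if $N_n\in\Phi$. $\top$ is concept $1$. $\triangle C$ abbreviates $\neg\mathord{\sim}C$. $\mathcal L'^{\triangle}_\Phi$ is the largest sublanguage of $\mathcal L^{\sim}_\Phi$ that disallows the role constructors $R\circ S$, $R\sqcup S$, $R^*$, $C?$ and the concept constructors $C\sqcup D$, $\forall R.C$, ${<}n\,R.C$,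 ${<}n\,R$, uses $\to$ only in the forms $C\to p$ or $p\to C$ ($p\in[0,1]$), and uses $\neg$ and $\mathord{\sim}$ only in the form $\neg\mathord{\sim}C$. A fuzzy interpretation $\mathcal I$ has a nonempty domain $\Delta^{\mathcal I}$, $a^{\mathcal I}\in\Delta^{\mathcal I}$, $A^{\mathcal I}:\Delta^{\mathcal I}\to[0,1]$, $r^{\mathcal I}:(\Delta^{\mathcal I})^2\to[0,1]$, extended by: $U^{\mathcal I}\equiv1$; $(R^-)^{\mathcal I}(x,y)=R^{\mathcal I}(y,x)$; $(C?)^{\mathcal I}(x,y)=C^{\mathcal I}(x)$ if $x=y$, else $0$; $(R\circ S)^{\mathcal I}(x,y)=\sup_z R^{\mathcal I}(x,z)\otimes S^{\mathcal I}(z,y)$; $(R\sqcup S)^{\mathcal I}=R^{\mathcal I}\oplus S^{\mathcal I}$; $(R^* )^{\mathcal I}(x,y)=\sup\{\min(\{1\}\cup\{R^{\mathcal I}(x_i,x_{i+1})\mid i<n\})\mid n\ge0,x_0=x,x_n=y\}$; $p^{\mathcal I}(x)=p$; $\{a\}^{\mathcal I}(x)=1$ iff $x=a^{\mathcal I}$, else $0$; $(\neg C)^{\mathcal I}=\ominus C^{\mathcal I}$; $(\mathord{\sim}C)^{\mathcal I}(x)=1-C^{\mathcal I}(x)$ (so $(\triangle C)^{\mathcal I}(x)=1$ if $C^{\mathcal I}(x)=1$ and $0$ otherwise); $\sqcap,\sqcup,\to$ pointwise by $\otimes,\oplus,\Rightarrow$; $(\exists r.\mathit{Self})^{\mathcal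 I}(x)=r^{\mathcal I}(x,x)$; $(\exists R.C)^{\mathcal I}(x)=\sup_y R^{\mathcal I}(x,y)\otimes C^{\mathcal I}(y)$; $(\forall R.C)^{\mathcal I}(x)=\inf_y(R^{\mathcal I}(x,y)\Rightarrow C^{\mathcal I}(y))$; $({\ge}n\,R.C)^{\mathcal I}(x)=\sup\{\min_i(R^{\mathcal I}(x,y_i)\otimes C^{\mathcal I}(y_i))\mid y_1..y_n$ pairwise distinct$\}$; $({<}n\,R.C)^{\mathcal I}(x)=\inf\{\min_i(R^{\mathcal I}(x,y_i)\otimes C^{\mathcal I}(y_i))\Rightarrow e\mid y_1..y_n\}$ with $e=1$ if some $y_j=y_k$ ($j<k$), else $0$; ${\ge}n\,R={\ge}n\,R.\top$, ${<}n\,R={<}n\,R.\top$. Witnessed w.r.t. $\mathcal L'^{\triangle}_\Phi$: for roles/concepts of $\mathcal L'^{\triangle}_\Phi$, every infinite set whose infimum (supremum) is taken above has a least (greatest) element. $\mathcal I$ is modally saturated w.r.t. $\mathcal L'^{\triangle}_\Phi$ if: (1) for every $p\in(0,1]$, $x\in\Delta^{\mathcal I}$, basic role $R$ and infinite set $\Gamma$ of concepts of $\mathcal L'^{\triangle}_\Phi$: if for every finite $\Lambda\subseteq\Gamma$ there is $y$ with $R^{\mathcal I}(x,y)\otimes C^{\mathcal I}(y)\ge p$ for all $C\in\Lambda$, then there is $y$ with $R^{\mathcal I}(x,y)\ge p$ and $C^{\mathcal I}(y)>0$ for all $C\in\Gamma$; (2) if $Q_n\in\Phi$: for all such $p,x,R,\Gamma$,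 if for every finite $\Lambda\subseteq\Gamma$ there are pairwise distinct $y_1..y_n$ with $R^{\mathcal I}(x,y_i)\otimes C^{\mathcal I}(y_i)\ge p$ for all $i$ and $C\in\Lambda$, then there are pairwise distinct $y_1..y_n$ with $R^{\mathcal I}(x,y_i)\ge p$ and $C^{\mathcal I}(y_i)>0$ for all $i$ and $C\in\Gamma$; (3) if $U\in\Phi$: for every infinite set $\Gamma$ of concepts of $\mathcal L'^{\triangle}_\Phi$, if for every finite $\Lambda\subseteq\Gamma$ there is $y$ with $C^{\mathcal I}(y)=1$ for all $C\in\Lambda$, then there is $y$ with $C^{\mathcal I}(y)>0$ for all $C\in\Gamma$. A crisp $\Phi$-bisimulation between $\mathcal I,\mathcal I'$ is $Z:\Delta^{\mathcal I}\times\Delta^{\mathcal I'}\to\{0,1\}$ such that, for all $x,x',A\in\mathsf{CN},a\in\mathsf{IN},r\in\mathsf{RN}$ and basic $R$: (i) $Z(x,x')\le(A^{\mathcal I}(x)\Leftrightarrow A^{\mathcal I'}(x'))$; (ii) $\forall y\exists y'$: $Z(x,x')\otimes R^{\mathcal I}(x,y)\le Z(y,y')\otimes R^{\mathcal I'}(x',y')$; (iii) $\forall y'\exists y$: $Z(x,x')\otimes R^{\mathcal I'}(x',y')\le Z(y,y')\otimes R^{\mathcal I}(x,y)$; (iv) if $O\in\Phi$: $Z(x,x')=0$ whenever exactly one of $x=a^{\mathcal I}$, $x'=a^{\mathcal I'}$ holds; (v) if $U\in\Phi$: $\forall y\exists y'$ $Z(x,x')\le Z(y,y')$ and $\forall y'\exists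 y$ $Z(x,x')\le Z(y,y')$; (vi) if $\mathit{Self}\in\Phi$: $Z(x,x')\le(r^{\mathcal I}(x,x)\Leftrightarrow r^{\mathcal I'}(x',x'))$; (vii) if $Q_n\in\Phi$: if $Z(x,x')>0$ and $y_1..y_n$ pairwise distinct with all $R^{\mathcal I}(x,y_j)>0$, there exist pairwise distinct $y'_1..y'_n$ such that for each $i$ some $j$ has $Z(x,x')\otimes\bigotimes_k R^{\mathcal I}(x,y_k)\le Z(y_j,y'_i)\otimes R^{\mathcal I'}(x',y'_i)$, and symmetrically (from pairwise distinct $y'_1..y'_n$ with $R^{\mathcal I'}(x',y'_j)>0$ obtain pairwise distinct $y_1..y_n$ such that for each $i$ some $j$ has $Z(x,x')\otimes\bigotimes_k R^{\mathcal I'}(x',y'_k)\le Z(y_i,y'_j)\otimes R^{\mathcal I}(x,y_i)$); (viii) if $N_n\in\Phi$: as (vii) with right-hand sides $R^{\mathcal I'}(x',y'_i)$ for all $i$, resp. $R^{\mathcal I}(x,y_i)$ for all $i$. *)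

(* Defs.v *)
From HB Require Import structures.
From mathcomp Require Import all_boot all_order all_algebra.
From mathcomp Require Import mathcomp_extra boolp classical_sets functions.
From mathcomp Require Import cardinality reals.

Set Implicit Arguments.
Unset Strict Implicit.
Unset Printing Implicit Defensive.

Import Order.TTheory GRing.Theory Num.Theory.
Local Open Scope classical_set_scope.
Local Open Scope ring_scope.

(* Truth degrees are elements of [R : realType];
   membership in [0, 1] is imposed on interpretations (record [interp]) and on
   the constants of the language ([is_concept]). *)

Section Goedel.
Context {R : realType}.
Implicit Types p q : R.

Definition gtnorm p q : R := Num.min p q.
Definition gsnorm p q : R := Num.max p q.
Definition gneg p : R := if p == 0 then 1 else 0.
Definition gimp p q : R := if p <= q then 1 else q.
Definition giff p q : R := gtnorm (gimp p q) (gimp q p).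

(* [1] is the neutral element of the t-norm on [0, 1], so for n > 0 and degrees
   in [0, 1] this is the minimum of the p i; for n = 0 it is 1. *)
Definition gmin n (p : 'I_n -> R) : R := \big[gtnorm/1]_(i < n) p i.

End Goedel.

Inductive feature := FI | FO | FU | FSelf | FQ of nat | FN of nat.

(* The indices of Q_n and N_n range over the positive integers. *)
Definition features : set feature :=
  [set f | match f with FQ n | FN n => (0 < n)%N | _ => True end].

(* Raw syntax; the constraints depending on Phi are imposed by [is_role] and
   [is_concept].  The disjoint sets of concept, role and individual names are
   three separate types. *)
Inductive role (R : realType) (CN RN IN : Type) : Type :=
| RName of RN
| RComp of role R CN RN IN & role R CN RN IN
| RUnion of role R CN RN IN & role R CN RN IN
| RStar of role R CN RN IN
| RTest of concept R CN RN IN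
| RInv of role R CN RN IN
| RUniv
with concept (R : realType) (CN RN IN : Type) : Type :=
| CConst of R
| CName of CN
| CAnd of concept R CN RN IN & concept R CN RN IN
| CImp of concept R CN RN IN & concept R CN RN IN
| CNeg of concept R CN RN IN                              (* Goedel negation *)
| COr of concept R CN RN IN & concept R CN RN IN
| CTilde of concept R CN RN IN                       (* involutive negation *)
| CForall of role R CN RN IN & concept R CN RN IN
| CExists of role R CN RN IN & concept R CN RN IN
| CNominal of IN
| CSelf of RN
| CGe of nat & role R CN RN IN & concept R CN RN IN
| CLt of nat & role R CN RN IN & concept R CN RN IN
| CGeN of nat & role R CN RN IN
| CLtN of nat & role R CN RN IN.

Scheme role_mut_ind := Induction for role Sort Prop
with concept_mut_ind := Induction for concept Sort Prop.
Combined Scheme role_concept_ind from role_mut_ind, concept_mut_ind.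

Arguments RName {R CN RN IN}.
Arguments RUniv {R CN RN IN}.
Arguments CConst {R CN RN IN}.
Arguments CName {R CN RN IN}.
Arguments CNominal {R CN RN IN}.
Arguments CSelf {R CN RN IN}.

Section Language.
Context {R : realType} {CN RN IN : Type}.
Local Notation role := (role R CN RN IN).
Local Notation concept := (concept R CN RN IN).

Definition basic_role (Phi : set feature) (T : role) : Prop :=
  match T with
  | RName _ => True
  | RInv (RName _) => Phi FI
  | _ => False
  end.

Fixpoint is_role (Phi : set feature) (T : role) : Prop :=
  match T with
  | RName _ => True
  | RComp T1 T2 | RUnion T1 T2 => is_role Phi T1 /\ is_role Phi T2
  | RStar T1 => is_role Phi T1
  | RTest C => is_concept Phi C
  | RInv T1 => Phi FI /\ is_role Phi T1
  | RUniv => Phi FU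
  end
with is_concept (Phi : set feature) (C : concept) : Prop :=
  match C with
  | CConst p => 0 <= p <= 1
  | CName _ => True
  | CAnd C1 C2 | CImp C1 C2 | COr C1 C2 => is_concept Phi C1 /\ is_concept Phi C2
  | CNeg C1 | CTilde C1 => is_concept Phi C1
  | CForall T C1 | CExists T C1 => is_role Phi T /\ is_concept Phi C1
  | CNominal _ => Phi FO
  | CSelf _ => Phi FSelf
  | CGe n T C1 | CLt n T C1 => [/\ Phi (FQ n), basic_role Phi T & is_concept Phi C1]
  | CGeN n T | CLtN n T => Phi (FN n) /\ basic_role Phi T
  end.

(* The syntactic restrictions cutting out the sublanguage: implication only with
   a constant on one side, and the two negations only in the combination
   [CNeg (CTilde C)] (the Baaz projection of C). *)
Fixpoint restricted_role (T : role) : Prop :=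
  match T with
  | RName _ | RUniv => True
  | RInv T1 => restricted_role T1
  | RComp _ _ | RUnion _ _ | RStar _ | RTest _ => False
  end.

Fixpoint restricted_concept (C : concept) : Prop :=
  match C with
  | CConst _ | CName _ | CNominal _ | CSelf _ => True
  | CAnd C1 C2 => restricted_concept C1 /\ restricted_concept C2
  | CImp (CConst _) C1 | CImp C1 (CConst _) => restricted_concept C1
  | CNeg (CTilde C1) => restricted_concept C1
  | CExists T C1 | CGe _ T C1 => restricted_role T /\ restricted_concept C1
  | CGeN _ T => restricted_role T
  | CImp _ _ | CNeg _ | CTilde _ | COr _ _ | CForall _ _ | CLt _ _ _
  | CLtN _ _ => False
  end.

Definition Ltri_role (Phi : set feature) : set role :=
  [set T | is_role Phi T /\ restricted_role T].

Definition Ltri_concept (Phi : set feature) : set concept :=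
  [set C | is_concept Phi C /\ restricted_concept C].

End Language.

Record interp (R : realType) (CN RN IN : Type) := Interp {
  dom : Type;
  dom_inhabited : inhabited dom;
  iname : IN -> dom;
  cname : CN -> dom -> R;
  rname : RN -> dom -> dom -> R;
  cname_itv : forall A x, 0 <= cname A x <= 1;
  rname_itv : forall r x y, 0 <= rname r x y <= 1
}.

(* The sets of degrees whose suprema/infima define the semantics.  Recall that
   [sup set0 = 0], which is the supremum of the empty set in [0, 1]; only
   [ge_set] can be empty. *)
Section DegreeSets.
Context {R : realType} {D : Type}.
Implicit Types (T : D -> D -> R) (C : D -> R) (x y : D).

Definition comp_set T T' x y : set R :=
  [set gtnorm (T x z) (T' z y) | z in [set: D]].

Definition star_set T x y : set R :=
  [set v | exists (n : nat) (c : nat -> D), [/\ c 0%N = x, c n = y &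
     v = gmin (fun i : 'I_n => T (c i) (c i.+1))]].

Definition exists_set T C x : set R :=
  [set gtnorm (T x y) (C y) | y in [set: D]].

Definition forall_set T C x : set R :=
  [set gimp (T x y) (C y) | y in [set: D]].

Definition ge_set n T C x : set R :=
  [set gmin (fun i => gtnorm (T x (y i)) (C (y i))) |
     y in [set y : 'I_n -> D | injective y]].

Definition lt_set n T C x : set R :=
  [set gimp (gmin (fun i => gtnorm (T x (y i)) (C (y i))))
            (if `[< exists j k : 'I_n, (j < k)%N /\ y j = y k >] then 1 else 0) |
     y in [set: 'I_n -> D]].

End DegreeSets.

Section Semantics.
Context {R : realType} {CN RN IN : Type}.
Local Notation role := (role R CN RN IN).
Local Notation concept := (concept R CN RN IN).
Local Notation interp := (interp R CN RN IN).

Unset Implicit Arguments.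
Fixpoint evalR (I : interp) (T : role) : dom I -> dom I -> R :=
  match T with
  | RName r => rname r
  | RComp T1 T2 => fun x y => sup (comp_set (evalR I T1) (evalR I T2) x y)
  | RUnion T1 T2 => fun x y => gsnorm (evalR I T1 x y) (evalR I T2 x y)
  | RStar T1 => fun x y => sup (star_set (evalR I T1) x y)
  | RTest C => fun x y => if `[< x = y >] then evalC I C x else 0
  | RInv T1 => fun x y => evalR I T1 y x
  | RUniv => fun _ _ => 1
  end
with evalC (I : interp) (C : concept) : dom I -> R :=
  match C with
  | CConst p => fun _ => p
  | CName A => cname A
  | CAnd C1 C2 => fun x => gtnorm (evalC I C1 x) (evalC I C2 x)
  | CImp C1 C2 => fun x => gimp (evalC I C1 x) (evalC I C2 x)
  | CNeg C1 => fun x => gneg (evalC I C1 x)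
  | COr C1 C2 => fun x => gsnorm (evalC I C1 x) (evalC I C2 x)
  | CTilde C1 => fun x => 1 - evalC I C1 x
  | CForall T C1 => fun x => inf (forall_set (evalR I T) (evalC I C1) x)
  | CExists T C1 => fun x => sup (exists_set (evalR I T) (evalC I C1) x)
  | CNominal a => fun x => if `[< x = iname I a >] then 1 else 0
  | CSelf r => fun x => rname r x x
  | CGe n T C1 => fun x => sup (ge_set n (evalR I T) (evalC I C1) x)
  | CLt n T C1 => fun x => inf (lt_set n (evalR I T) (evalC I C1) x)
  | CGeN n T => fun x => sup (ge_set n (evalR I T) (fun=> 1) x)
  | CLtN n T => fun x => inf (lt_set n (evalR I T) (fun=> 1) x)
  end.
Set Implicit Arguments.

Definition attains_sup (V : set R) : Prop :=
  infinite_set V -> exists2 m, V m & ubound V m.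

Definition attains_inf (V : set R) : Prop :=
  infinite_set V -> exists2 m, V m & lbound V m.

Record witnessed (LR : set role) (LC : set concept) (I : interp) : Prop := {
  witnessed_comp : forall T T' x y, LR (RComp T T') ->
    attains_sup (comp_set (evalR I T) (evalR I T') x y);
  witnessed_star : forall T x y, LR (RStar T) ->
    attains_sup (star_set (evalR I T) x y);
  witnessed_forall : forall T C x, LC (CForall T C) ->
    attains_inf (forall_set (evalR I T) (evalC I C) x);
  witnessed_exists : forall T C x, LC (CExists T C) ->
    attains_sup (exists_set (evalR I T) (evalC I C) x);
  witnessed_ge : forall n T C x, LC (CGe n T C) ->
    attains_sup (ge_set n (evalR I T) (evalC I C) x);
  witnessed_lt : forall n T C x, LC (CLt n T C) ->
    attains_inf (lt_set n (evalR I T) (evalC I C) x);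
  witnessed_geN : forall n T x, LC (CGeN n T) ->
    attains_sup (ge_set n (evalR I T) (fun=> 1) x);
  witnessed_ltN : forall n T x, LC (CLtN n T) ->
    attains_inf (lt_set n (evalR I T) (fun=> 1) x)
}.

Record modally_saturated (Phi : set feature) (I : interp) : Prop := {
  saturated_basic : forall (p : R) (x : dom I) (T : role) (Gamma : set concept),
    0 < p <= 1 -> basic_role Phi T ->
    infinite_set Gamma -> Gamma `<=` Ltri_concept Phi ->
    (forall Lam : set concept, finite_set Lam -> Lam `<=` Gamma ->
       exists y, forall C, Lam C -> p <= gtnorm (evalR I T x y) (evalC I C y)) ->
    exists y, p <= evalR I T x y /\ forall C, Gamma C -> 0 < evalC I C y;
  saturated_Q : forall n, Phi (FQ n) ->
    forall (p : R) (x : dom I) (T : role) (Gamma : set concept),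
    0 < p <= 1 -> basic_role Phi T ->
    infinite_set Gamma -> Gamma `<=` Ltri_concept Phi ->
    (forall Lam : set concept, finite_set Lam -> Lam `<=` Gamma ->
       exists2 y : 'I_n -> dom I, injective y & forall i C, Lam C ->
         p <= gtnorm (evalR I T x (y i)) (evalC I C (y i))) ->
    exists2 y : 'I_n -> dom I, injective y &
      forall i, p <= evalR I T x (y i) /\
                forall C, Gamma C -> 0 < evalC I C (y i);
  saturated_U : Phi FU ->
    forall Gamma : set concept,
    infinite_set Gamma -> Gamma `<=` Ltri_concept Phi ->
    (forall Lam : set concept, finite_set Lam -> Lam `<=` Gamma ->
       exists y, forall C, Lam C -> evalC I C y = 1) ->
    exists y, forall C, Gamma C -> 0 < evalC I C y
}.

(* Crisp fuzzy relations are bool-valued; the degree of (x, x') is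
   [(Z x x')%:R]. *)
Record crisp_bisimulation (Phi : set feature) (I I' : interp)
    (Z : dom I -> dom I' -> bool) : Prop := {
  bisim_name : forall x x' A,
    (Z x x')%:R <= giff (cname A x) (cname A x');
  bisim_forth : forall x x' T, basic_role Phi T -> forall y, exists y',
    gtnorm (Z x x')%:R (evalR I T x y) <= gtnorm (Z y y')%:R (evalR I' T x' y');
  bisim_back : forall x x' T, basic_role Phi T -> forall y', exists y,
    gtnorm (Z x x')%:R (evalR I' T x' y') <= gtnorm (Z y y')%:R (evalR I T x y);
  bisim_O : Phi FO -> forall x x' a,
    (x = iname I a /\ x' <> iname I' a) \/ (x <> iname I a /\ x' = iname I' a) ->
    Z x x' = false;
  bisim_U_forth : Phi FU -> forall x x' y, exists y',
    (Z x x')%:R <= (Z y y')%:R :> R;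
  bisim_U_back : Phi FU -> forall x x' y', exists y,
    (Z x x')%:R <= (Z y y')%:R :> R;
  bisim_Self : Phi FSelf -> forall x x' r,
    (Z x x')%:R <= giff (rname r x x) (rname r x' x');
  bisim_Q_forth : forall n, Phi (FQ n) ->
    forall x x' T (y : 'I_n -> dom I), basic_role Phi T ->
    0 < (Z x x')%:R :> R -> injective y -> (forall j, 0 < evalR I T x (y j)) ->
    exists2 y' : 'I_n -> dom I', injective y' & forall i, exists j,
      gtnorm (Z x x')%:R (gmin (fun k => evalR I T x (y k)))
      <= gtnorm (Z (y j) (y' i))%:R (evalR I' T x' (y' i));
  bisim_Q_back : forall n, Phi (FQ n) ->
    forall x x' T (y' : 'I_n -> dom I'), basic_role Phi T ->
    0 < (Z x x')%:R :> R -> injective y' -> (forall j, 0 < evalR I' T x' (y' j)) ->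
    exists2 y : 'I_n -> dom I, injective y & forall i, exists j,
      gtnorm (Z x x')%:R (gmin (fun k => evalR I' T x' (y' k)))
      <= gtnorm (Z (y i) (y' j))%:R (evalR I T x (y i));
  bisim_N_forth : forall n, Phi (FN n) ->
    forall x x' T (y : 'I_n -> dom I), basic_role Phi T ->
    0 < (Z x x')%:R :> R -> injective y -> (forall j, 0 < evalR I T x (y j)) ->
    exists2 y' : 'I_n -> dom I', injective y' & forall i,
      gtnorm (Z x x')%:R (gmin (fun k => evalR I T x (y k)))
      <= evalR I' T x' (y' i);
  bisim_N_back : forall n, Phi (FN n) ->
    forall x x' T (y' : 'I_n -> dom I'), basic_role Phi T ->
    0 < (Z x x')%:R :> R -> injective y' -> (forall j, 0 < evalR I' T x' (y' j)) ->
    exists2 y : 'I_n -> dom I, injective y & forall i,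
      gtnorm (Z x x')%:R (gmin (fun k => evalR I' T x' (y' k)))
      <= evalR I T x (y i)
}.

Definition indist (Phi : set feature) (I I' : interp)
    (x : dom I) (x' : dom I') : bool :=
  `[< forall C, Ltri_concept Phi C -> evalC I C x = evalC I' C x' >].

End Semantics.

(* Main.v *)
(** Given finitely many points y_1, ..., y_n of one interpretation, let Gamma be
    the set of concepts of degree 1 at all of them.  If z has positive degree for
    every concept in Gamma, then z is indistinguishable from some y_j: otherwise
    pick C_j separating y_j from z; the crisp test that C_j has the degree it
    takes at y_j holds at y_j and fails at z, and the disjunction over j of these
    tests is in Gamma and has degree 0 at z.  For a finite part of Gamma with
    conjunction D, the concept (exists T.D) or (>= n T.D) has the same degree at
    x' as at x, and witnessedness provides the points satisfying this part; modal
    saturation passes from the finite parts to Gamma.  Conversely, bisimilar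
    points agree on every concept by induction. *)

Require Import Defs.
From mathcomp Require Import all_boot all_order all_algebra.
From mathcomp Require Import mathcomp_extra boolp classical_sets functions.
From mathcomp Require Import cardinality reals.

Set Implicit Arguments.
Unset Strict Implicit.
Unset Printing Implicit Defensive.

Import Order.TTheory GRing.Theory Num.Theory.
Local Open Scope classical_set_scope.
Local Open Scope ring_scope.

(** Indexing by ['I_n], repetitions allowed, makes finite sets of degrees or of concepts accessible
    to [arg_max] and to big operators. *)
Lemma finite_set_range (T : Type) (A : set T) :
  finite_set A -> exists n (f : 'I_n -> T), A = range f.
Proof.
move=> /(@finite_seqP {classic T}) [s ->].
exists (size s), (tnth (in_tuple s)); apply/seteqP; split=> [x /= xs|_ [i _ <-]].
  by have /tnthP[i ->] : x \in in_tuple s by []; exists i.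
exact: mem_tnth.
Qed.

(** * Goedel operations and suprema of degrees in [0, 1] *)

Section Truth_degrees.
Context {R : realType}.
Implicit Types (p q v : R) (V : set R).

Lemma le_gtnorm v p q : (v <= gtnorm p q) = (v <= p) && (v <= q).
Proof. exact: le_min. Qed.

Lemma gtnorm_itv p q : 0 <= p <= 1 -> 0 <= q <= 1 -> 0 <= gtnorm p q <= 1.
Proof. by move=> /andP[p0 p1] /andP[q0 q1]; rewrite le_gtnorm p0 q0 ge_min p1. Qed.

Lemma gmin_le1 n (p : 'I_n -> R) : gmin p <= 1.
Proof. exact: bigmin_le_id. Qed.

Lemma gmin_le n (p : 'I_n -> R) i : gmin p <= p i.
Proof. exact: bigmin_le. Qed.

Lemma le_gmin n v (p : 'I_n -> R) :
  v <= 1 -> (forall i, v <= p i) -> v <= gmin p.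
Proof. by move=> v1 vp; apply: le_bigmin. Qed.

Lemma gmin_itv n (p : 'I_n -> R) :
  (forall i, 0 <= p i) -> 0 <= gmin p <= 1.
Proof.
by move=> p0; rewrite gmin_le1 le_gmin.
Qed.

Lemma gmin_gt0 n (p : 'I_n -> R) : 0 < gmin p -> forall i, 0 < p i.
Proof.
by move=> p0 i; apply: lt_le_trans p0 (gmin_le p i).
Qed.

Lemma gmin_pos n (p : 'I_n -> R) : (forall i, 0 < p i) -> 0 < gmin p.
Proof.
move=> p0; apply: (big_ind (fun v => 0 < v)) => // x y *.
by rewrite lt_min; apply/andP.
Qed.

Lemma gimp_itv p q : 0 <= q <= 1 -> 0 <= gimp p q <= 1.
Proof. by rewrite /gimp; case: ifP; rewrite ?ler01 ?lexx. Qed.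

Lemma giffxx p : giff p p = 1.
Proof. by rewrite /giff /gtnorm /gimp lexx minxx. Qed.

Lemma giff_ge0 p q : 0 <= p -> 0 <= q -> 0 <= giff p q.
Proof.
by move=> p0 q0; rewrite le_gtnorm /gimp; apply/andP; split; case: ifP.
Qed.

(** If one degree were strictly larger, one implication would return the smaller one, which is below
    1. *)
Lemma giff_ge1 p q : p <= 1 -> q <= 1 -> 1 <= giff p q -> p = q.
Proof.
move=> p1 q1; rewrite le_gtnorm /gimp => /andP[].
have [pq _|qp q1' _] := leP p q; last first.
  by have := lt_le_trans qp (le_trans p1 q1'); rewrite ltxx.
have [qp _|lpq p1'] := leP q p; first by apply/eqP; rewrite eq_le pq.
by have := lt_le_trans lpq (le_trans q1 p1'); rewrite ltxx.
Qed.

Lemma giffC p q : giff p q = giff q p.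
Proof. exact: minC. Qed.

Lemma ub_sup01 V v : (forall w, V w -> 0 <= w <= 1) -> V v -> v <= sup V.
Proof. by move=> V01 Vv; apply: ub_le_sup => //; exists 1 => w /V01/andP[]. Qed.

Lemma sup01 V : (forall w, V w -> 0 <= w <= 1) -> 0 <= sup V <= 1.
Proof.
move=> V01; have [->|/set0P[v Vv]] := eqVneq V set0; first by rewrite sup0 lexx ler01.
have /andP[v0 _] := V01 _ Vv.
rewrite (le_trans v0 (ub_sup01 V01 Vv)) ge_sup//; first by exists v.
by move=> w /V01/andP[].
Qed.

(** Since [sup W] is at least 0, only the positive elements of [V] need a bound in [W]; this matches
    the clauses of a bisimulation, which say something only about positive degrees. *)
Lemma le_sup01 V W : (forall w, V w -> 0 <= w <= 1) ->
  (forall w, W w -> 0 <= w <= 1) ->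
  (forall v, V v -> 0 < v -> exists2 w, W w & v <= w) -> sup V <= sup W.
Proof.
move=> V01 W01 VW; have /andP[W0 _] := sup01 W01.
have [->|/set0P V0] := eqVneq V set0; first by rewrite sup0.
apply: ge_sup => // v Vv; have [v0|v0] := ltP 0 v; last exact: le_trans v0 W0.
by have [w Ww /le_trans] := VW v Vv v0; apply; exact: ub_sup01.
Qed.

(** Positivity of [p] excludes the empty set, whose supremum is 0. A finite [V] has a maximum
    anyway, and an infinite one has it by [attains_sup]. *)
Lemma attained V p : attains_sup V -> 0 < p <= sup V -> exists2 v, V v & p <= v.
Proof.
move=> aV /andP[p0 pV].
have [V0|/set0P V0] := eqVneq V set0.
  by move: pV; rewrite V0 sup0 leNgt p0.
suff [m Vm mV] : exists2 m, V m & ubound V m.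
  by exists m => //; apply: le_trans pV _; apply: ge_sup.
have [/finite_set_range[n [f VE]]|/aV //] := pselect (finite_set V).
rewrite VE in V0 *; have [_ [i0 _ _]] := V0.
case: (@arg_maxP _ R _ i0 xpredT f isT) => i _ fi.
by exists (f i) => [|_ [j _ <-]]; [exists i|exact: fi].
Qed.

End Truth_degrees.

(** * Structure of the sublanguage and range of its degrees *)

Section Language.
Context {R : realType} {CN RN IN : Type} (Phi : set feature).
Local Notation role := (role R CN RN IN).
Local Notation concept := (concept R CN RN IN).
Local Notation interp := (interp R CN RN IN).
Implicit Types (C D : concept) (T : role) (p : R).

Lemma basic_Ltri T : basic_role Phi T -> Ltri_role Phi T.
Proof. by case: T => //=; case. Qed.

(** Inverses may be nested and applied to [RUniv]; semantically, double inverses cancel and the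
    universal role is its own inverse. *)
Lemma Ltri_roleP T : Ltri_role Phi T ->
  (exists2 T0, basic_role Phi T0 & forall I, evalR I T = evalR I T0) \/
  Phi FU /\ forall I, evalR I T = fun _ _ => 1.
Proof.
elim: T => [r|T1 _ T2 _|T1 _ T2 _|T1 _|C|T IH|] [rT sT] //.
- by left; exists (RName r).
- case: rT => FIP rT; have [[T0 T0P TE]|[UP TE]] := IH (conj rT sT).
    left; case: T0 T0P TE => // [r _ TE|[]//r _ TE].
      by exists (RInv (RName r)) => //= I; rewrite TE.
    by exists (RName r) => //= I; rewrite TE.
  by right; split=> // I /=; rewrite TE.
- by right.
Qed.

Lemma Ltri_ind (P : concept -> Prop) :
  (forall p, 0 <= p <= 1 -> P (CConst p)) ->
  (forall A, P (CName A)) ->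
  (forall C D, P C -> P D -> P (CAnd C D)) ->
  (forall C D, P C -> P D -> P (CImp C D)) ->
  (forall C, P C -> P (CNeg (CTilde C))) ->
  (forall T C, Ltri_role Phi T -> Ltri_concept Phi C -> P C ->
    P (CExists T C)) ->
  (forall a, Phi FO -> P (CNominal a)) ->
  (forall r, Phi FSelf -> P (CSelf r)) ->
  (forall n T C, Phi (FQ n) -> basic_role Phi T -> Ltri_concept Phi C -> P C ->
    P (CGe n T C)) ->
  (forall n T, Phi (FN n) -> basic_role Phi T -> P (CGeN n T)) ->
  forall C, Ltri_concept Phi C -> P C.
Proof.
move=> Pc PA Pand Pimp Ptri Pex Pnom Pself Pge PgeN.
(* An explicit fixpoint is used because the recursion goes from [CNeg (CTilde C)] straight to [C]:
   the intermediate [CTilde C] is outside the sublanguage. *)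
fix IH 1 => -[p|A|C D|C D|C|C D|C|T C|T C|a|r|n T C|n T C|n T|n T] [] //=.
- by move=> /Pc.
- by move=> [iC iD] [rC rD]; apply: Pand; apply: IH.
- move=> [iC iD] rCD.
  (* The constant side of an implication is itself in the sublanguage, so both sides get an
     induction hypothesis. *)
  suff [rC rD] : restricted_concept C /\ restricted_concept D.
    by apply: Pimp; apply: IH.
  by case: C rCD {iC iD IH} => // >; case: D => > //=.
- case: C => // C iC rC; exact/Ptri/IH.
- by move=> [iT iC] [rT rC]; apply: Pex => //; apply: IH.
- by move=> iO _; apply: Pnom.
- by move=> iS _; apply: Pself.
- by move=> [iQ iT iC] [rT rC]; apply: Pge => //; apply: IH.
- by move=> [iN iT] _; apply: PgeN.
Qed.

Lemma evalR_itv (I : interp) T x y : Ltri_role Phi T -> 0 <= evalR I T x y <= 1.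
Proof.
elim: T x y => [r|T1 _ T2 _|T1 _ T2 _|T1 _|C|T IH|] x y [rT sT] //=.
- exact: rname_itv.
- by case: rT => _ rT; apply: IH.
- by rewrite ler01 lexx.
Qed.

Section Degree_sets.
Context {D : Type} (T : D -> D -> R) (C : D -> R).
Hypothesis T01 : forall x y, 0 <= T x y <= 1.
Hypothesis C01 : forall x, 0 <= C x <= 1.

Lemma exists_set_itv x v : exists_set T C x v -> 0 <= v <= 1.
Proof. by move=> [y _ <-]; apply: gtnorm_itv. Qed.

Lemma ge_set_itv n x v : ge_set n T C x v -> 0 <= v <= 1.
Proof.
move=> [y _ <-]; apply: gmin_itv => i.
by case/andP: (gtnorm_itv (T01 x (y i)) (C01 (y i))).
Qed.

Lemma le_sup_exists_set x y p :
  p <= gtnorm (T x y) (C y) -> p <= sup (exists_set T C x).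
Proof.
move=> /le_trans; apply; apply: ub_sup01; last by exists y.
by move=> v; exact: exists_set_itv.
Qed.

Lemma le_sup_ge_set n x (y : 'I_n -> D) p : injective y ->
  p <= gmin (fun i => gtnorm (T x (y i)) (C (y i))) -> p <= sup (ge_set n T C x).
Proof.
move=> injy /le_trans; apply; apply: ub_sup01; last by exists y.
by move=> v; exact: ge_set_itv.
Qed.

End Degree_sets.

Lemma evalC_itv (I : interp) C x : Ltri_concept Phi C -> 0 <= evalC I C x <= 1.
Proof.
move=> hC; move: C hC x.
apply: Ltri_ind => //= [A x|C D IC ID x|C D IC ID x|C IC x|T C hT _ IC x
  |a _ x|r _ x|n T C _ /basic_Ltri hT _ IC x|n T _ /basic_Ltri hT x].
- exact: cname_itv.
- exact: gtnorm_itv.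
- exact: gimp_itv.
- by rewrite /gneg; case: ifP; rewrite ?lexx ler01.
- by apply: sup01 => v; apply: exists_set_itv => // y z; exact: evalR_itv.
- by case: ifP; rewrite ?lexx ler01.
- exact: rname_itv.
- by apply: sup01 => v; apply: ge_set_itv => // y z; exact: evalR_itv.
- apply: sup01 => v; apply: ge_set_itv => [y z|y]; first exact: evalR_itv.
  by rewrite lexx ler01.
Qed.

(** * Crisp tests, finite conjunctions and disjunctions inside the sublanguage *)

Lemma Ltri_const p : 0 <= p <= 1 -> Ltri_concept Phi (CConst p : concept).
Proof. by []. Qed.

Lemma Ltri_and C D :
  Ltri_concept Phi C -> Ltri_concept Phi D -> Ltri_concept Phi (CAnd C D).
Proof. by move=> [? ?] [? ?]. Qed.

Lemma Ltri_imp_const C p :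
  Ltri_concept Phi C -> 0 <= p <= 1 -> Ltri_concept Phi (CImp C (CConst p)).
Proof. by move=> [iC rC] p01; split=> //; case: C rC {iC}. Qed.

Lemma Ltri_const_imp C p :
  Ltri_concept Phi C -> 0 <= p <= 1 -> Ltri_concept Phi (CImp (CConst p) C).
Proof. by move=> [iC rC] p01. Qed.

(** The Baaz projection of the biconditional between [C] and the constant [p], built from the two
    permitted forms of implication. *)
Definition pin C p : concept :=
  CNeg (CTilde (CAnd (CImp C (CConst p)) (CImp (CConst p) C))).

Lemma Ltri_pin C p :
  Ltri_concept Phi C -> 0 <= p <= 1 -> Ltri_concept Phi (pin C p).
Proof.
move=> hC p01.
exact: (Ltri_and (Ltri_imp_const hC p01) (Ltri_const_imp hC p01)).
Qed.

Lemma eval_pin (I : interp) C p x : Ltri_concept Phi C -> 0 <= p <= 1 ->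
  evalC I (pin C p) x = if evalC I C x == p then 1 else 0.
Proof.
move=> hC /andP[_ p1] /=; have /andP[_ C1] := evalC_itv x hC.
(* The inner conjunction evaluates to a [giff], and its projection is 1 exactly when this [giff] is
   1. *)
rewrite -/(giff _ _) /gneg subr_eq0 eq_sym.
have [->|Cp] := eqVneq (evalC I C x) p; first by rewrite giffxx eqxx.
case: ifP => // /eqP giff1; case/eqP: Cp.
by apply: giff_ge1 => //; rewrite giff1.
Qed.

(** Folding from the constant 1, as [gmin] does, makes evaluation a morphism of big operators. *)
Definition big_and n (C : 'I_n -> concept) : concept :=
  \big[@CAnd _ _ _ _/CConst 1]_(i < n) C i.

Lemma Ltri_big_and n (C : 'I_n -> concept) :
  (forall i, Ltri_concept Phi (C i)) -> Ltri_concept Phi (big_and C).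
Proof.
move=> hC; apply: (big_ind (fun D => Ltri_concept Phi D)) => //.
- by apply: Ltri_const; rewrite ler01 lexx.
- exact: Ltri_and.
Qed.

Lemma eval_big_and (I : interp) n (C : 'I_n -> concept) x :
  evalC I (big_and C) x = gmin (fun i => evalC I (C i) x).
Proof. exact: (big_morph (fun D => evalC I D x)). Qed.

(* The language has no disjunction, but [C -> 0] is the Goedel negation of C, so
   De Morgan's law gives the disjunction of crisp concepts. *)
Definition not_all_not n (C : 'I_n -> concept) : concept :=
  CImp (big_and (fun i => CImp (C i) (CConst 0))) (CConst 0).

Lemma Ltri_not_all_not n (C : 'I_n -> concept) :
  (forall i, Ltri_concept Phi (C i)) -> Ltri_concept Phi (not_all_not C).
Proof.
have z01 : 0 <= (0 : R) <= 1 by rewrite lexx ler01.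
move=> hC; apply: Ltri_imp_const => //.
by apply: Ltri_big_and => i; apply: Ltri_imp_const.
Qed.

Lemma eval_not_all_not1 (I : interp) n (C : 'I_n -> concept) x i :
  evalC I (C i) x = 1 -> evalC I (not_all_not C) x = 1.
Proof.
move=> Ci; rewrite [LHS]/= eval_big_and /gimp ifT//.
apply: le_trans (gmin_le _ i) _ => /=.
by rewrite Ci /gimp ler10.
Qed.

Lemma eval_not_all_not0 (I : interp) n (C : 'I_n -> concept) x :
  (forall i, evalC I (C i) x = 0) -> evalC I (not_all_not C) x = 0.
Proof.
move=> C0; rewrite [LHS]/= eval_big_and /gimp ifF//; apply/negbTE; rewrite -ltNge.
by apply: gmin_pos => i /=; rewrite C0 /gimp lexx.
Qed.

(** * The concepts of degree 1 at finitely many points *)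

Definition true_at (I : interp) n (y : 'I_n -> dom I) : set concept :=
  [set C | Ltri_concept Phi C /\ forall j, evalC I C (y j) = 1].

(** Modal saturation speaks of infinite sets only. The concepts [q k -> 1], with the distinct
    constants 1/(k+1), have degree 1 everywhere and supply infinitely many members. *)
Lemma infinite_true_at (I : interp) n (y : 'I_n -> dom I) :
  infinite_set (true_at y).
Proof.
pose q (k : nat) : R := k.+1%:R^-1.
have q01 k : 0 <= q k <= 1 by rewrite invr_ge0 ler0n invf_le1 ?ler1n ?ltr0n.
pose f k : concept := CImp (CConst (q k)) (CConst 1).
have injf : injective f.
  by move=> k l [/invr_inj/eqP]; rewrite eqr_nat => /eqP[].
apply: contra_not infinite_nat => /(finite_preimage (f := f)) fin.
apply: sub_finite_set (fin _) => [k _|? ? _ _ /injf //].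
split=> [|j]; last by rewrite /= /gimp; case: ifP.
by apply: Ltri_const_imp => //; apply: Ltri_const; rewrite ler01 lexx.
Qed.

Lemma true_at_indist (I I' : interp) n (y : 'I_n -> dom I) (z : dom I') :
  (forall C, true_at y C -> 0 < evalC I' C z) -> exists j, indist Phi (y j) z.
Proof.
move=> yz; apply: contrapT => /forallNP nyz.
have /choice[C CP] : forall j, exists C,
    Ltri_concept Phi C /\ evalC I C (y j) <> evalC I' C z.
  move=> j; apply: contrapT => /forallNP nC; apply: (nyz j); apply/asboolP => C hC.
  by apply: contrapT => ?; apply: (nC C).
pose D j := pin (C j) (evalC I (C j) (y j)).
have C01 j : 0 <= evalC I (C j) (y j) <= 1 by apply: evalC_itv; case: (CP j).
have hD j : Ltri_concept Phi (D j) by apply: Ltri_pin => //; case: (CP j).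
(* The disjunction of the tests has degree 1 at each [y j], by its [j]-th member, so it must be
   positive at [z], where all tests fail. For [n = 0] it is the empty disjunction, of degree 0, and
   the contradiction persists. *)
have : 0 < evalC I' (not_all_not D) z.
  apply: yz; split=> [|j]; first exact: Ltri_not_all_not.
  by apply: (@eval_not_all_not1 _ _ _ _ j); rewrite eval_pin ?eqxx//; case: (CP j).
rewrite eval_not_all_not0 ?ltxx// => j; have [hC /eqP/negbTE neq] := CP j.
by rewrite eval_pin// eq_sym neq.
Qed.

Lemma indistP (I I' : interp) (x : dom I) (x' : dom I') : indist Phi x x' ->
  forall C, Ltri_concept Phi C -> evalC I C x = evalC I' C x'.
Proof. by move/asboolP. Qed.

Lemma indistC (I I' : interp) (x : dom I) (x' : dom I') :
  indist Phi x x' = indist Phi x' x.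
Proof. by apply: asbool_equiv_eq; split=> xx' C /xx'. Qed.

(** The conjunction of [Lam] lies below each of its members in every interpretation, so one modal
    concept over it handles the whole finite set. *)
Lemma finite_true_at (I : interp) n (y : 'I_n -> dom I) (Lam : set concept) :
  finite_set Lam -> Lam `<=` true_at y -> exists D, true_at y D /\
    forall (I' : interp) z C, Lam C -> evalC I' D z <= evalC I' C z.
Proof.
move=> /finite_set_range[m [C ->]] LamP; exists (big_and C).
have hC i : true_at y (C i) by apply: LamP; exists i.
split; first split=> [|j].
- by apply: Ltri_big_and => i; case: (hC i).
- rewrite eval_big_and; apply/eqP; rewrite eq_le.
  have C1 i : evalC I (C i) (y j) = 1 by case: (hC i).
  by rewrite gmin_le1 le_gmin// => i; rewrite C1.
- by move=> I' z _ [i _ <-]; rewrite eval_big_and; exact: gmin_le.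
Qed.

End Language.

Section Hennessy_Milner.
Context {R : realType} {CN RN IN : Type} (Phi : set feature).
Local Notation role := (role R CN RN IN).
Local Notation concept := (concept R CN RN IN).
Local Notation interp := (interp R CN RN IN).

(** * Transferring successors between indistinguishable points *)

Section Forth.
Context (I I' : interp).
Hypothesis wI' : witnessed (Ltri_role Phi) (Ltri_concept Phi) I'.
Hypothesis sI' : modally_saturated Phi I'.
Implicit Types (T : role) (p : R).

(** The point [y] shows that [CExists T C] has degree at least [p] at [x], hence also at [x'], where
    the supremum is attained. General roles are allowed so that [RUniv] is covered. *)
Lemma exists_transfer (x : dom I) (x' : dom I') T (C : concept) y p : Ltri_role Phi T ->
  indist Phi x x' -> Ltri_concept Phi C -> 0 < p ->
  p <= evalR I T x y -> evalC I C y = 1 ->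
  exists y', p <= gtnorm (evalR I' T x' y') (evalC I' C y').
Proof.
move=> hT xx' hC p0 pT C1.
have hE : Ltri_concept Phi (CExists T C) by case: hT hC => [? ?] [? ?].
have pE : p <= evalC I (CExists T C) x.
  have [_ T1] := andP (evalR_itv x y hT).
  apply: (le_sup_exists_set (T := evalR I T) (C := evalC I C) _ _ (y := y)).
  - by move=> *; exact: evalR_itv hT.
  - by move=> *; exact: evalC_itv hC.
  - by rewrite le_gtnorm pT C1 (le_trans pT).
rewrite (indistP xx' hE) in pE.
have [|_ [y' _ <-] py'] := attained (p := p) (witnessed_exists wI' (x := x') hE).
  by rewrite p0.
by exists y'.
Qed.

Lemma indist_forth (x : dom I) (x' : dom I') T y : basic_role Phi T -> indist Phi x x' ->
  0 < evalR I T x y ->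
  exists2 y', indist Phi y y' & evalR I T x y <= evalR I' T x' y'.
Proof.
move=> bT xx' p0; have hT := basic_Ltri bT.
have [_ p1] := andP (evalR_itv x y hT).
(* A single point is treated as a family of length one. *)
pose ys (_ : 'I_1) := y.
(* Saturation is applied at the level of the role degree itself, which yields the required
   inequality. *)
have [|||||y' [pT py']] := saturated_basic sI' (p := evalR I T x y) (x := x') (T := T)
    (Gamma := true_at Phi ys); rewrite ?p0 //.
- exact: infinite_true_at.
- by move=> C [].
- move=> Lam finL LamP; have [D [[hD D1] LD]] := finite_true_at finL LamP.
  have [y' py'] := exists_transfer hT xx' hD p0 (lexx _) (D1 ord0).
  exists y' => C LC; move: py'; rewrite !le_gtnorm => /andP[-> pD].
  exact: le_trans pD (LD _ _ _ LC).
- by have [j yy'] := true_at_indist py'; exists y'.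
Qed.

Lemma indist_U_forth (x : dom I) (x' : dom I') (y : dom I) : Phi FU -> indist Phi x x' ->
  exists y' : dom I', indist Phi y y'.
Proof.
move=> UP xx'; pose ys (_ : 'I_1) := y.
have [|||y' py'] := saturated_U sI' UP (Gamma := true_at Phi ys).
- exact: infinite_true_at.
- by move=> C [].
- move=> Lam finL LamP; have [D [[hD D1] LD]] := finite_true_at finL LamP.
  have hU : Ltri_role Phi (RUniv : role) by split.
  (* The universal role has degree 1 everywhere, so the level can be 1, as saturation for [U]
     demands degree exactly 1. *)
  have [y' py'] := exists_transfer hU xx' hD ltr01 (lexx 1) (D1 ord0).
  exists y' => C LC; have [hC _] := LamP _ LC.
  move: py'; rewrite le_gtnorm => /andP[_ D1'].
  have [_ C1] := andP (evalC_itv y' hC).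
  by apply/eqP; rewrite eq_le C1 (le_trans D1' (LD _ _ _ LC)).
- by have [j yy'] := true_at_indist py'; exists y'.
Qed.

(** The counting concept does not say which [y' i] answers which [y j]. Using the concepts true at
    all [y j] together, each [y' i] is still matched with some [y j]. *)
Lemma indist_Q_forth n (x : dom I) (x' : dom I') T (y : 'I_n -> dom I) : Phi (FQ n) ->
  basic_role Phi T -> indist Phi x x' -> injective y ->
  (forall j, 0 < evalR I T x (y j)) ->
  exists2 y' : 'I_n -> dom I', injective y' & forall i,
    gmin (fun k => evalR I T x (y k)) <= evalR I' T x' (y' i) /\
    exists j, indist Phi (y j) (y' i).
Proof.
move=> QP bT xx' injy T0; have hT := basic_Ltri bT.
(* The level is the least of finitely many positive role degrees, and is 1 when [n = 0]. *)
set p := gmin _; have p0 : 0 < p by exact: gmin_pos.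
have p1 : p <= 1 by exact: gmin_le1.
have pT i : p <= evalR I T x (y i) by exact: gmin_le.
have [|||||y' injy' py'] := saturated_Q sI' QP (p := p) (x := x') (T := T)
    (Gamma := true_at Phi y); rewrite ?p0 //.
- exact: infinite_true_at.
- by move=> C [].
- move=> Lam finL LamP; have [D [[hD D1] LD]] := finite_true_at finL LamP.
  have hE : Ltri_concept Phi (CGe n T D) by case: hT hD => [? ?] [? ?].
  have pE : p <= evalC I (CGe n T D) x.
    apply: (le_sup_ge_set (T := evalR I T) (C := evalC I D) _ _ (y := y)) => //.
    + by move=> *; exact: evalR_itv hT.
    + by move=> *; exact: evalC_itv hD.
    + by apply: le_gmin => // i; rewrite le_gtnorm pT D1.
  rewrite (indistP xx' hE) in pE.
  have [|_ [y' injy' <-] py'] := attained (p := p) (witnessed_ge wI' (x := x') hE).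
    by rewrite p0.
  have {}py' i := le_trans py' (gmin_le _ i).
  exists y' => // i C LC; move: (py' i); rewrite !le_gtnorm => /andP[-> pD].
  exact: le_trans pD (LD _ _ _ LC).
- exists y' => // i; have [pTi Ci] := py' i.
  by split=> //; exact: true_at_indist Ci.
Qed.

(** A family attaining the supremum of [CGeN n T] at [x'] is already the required one, since only
    role degrees are compared. *)
Lemma indist_N_forth n (x : dom I) (x' : dom I') T (y : 'I_n -> dom I) : Phi (FN n) ->
  basic_role Phi T -> indist Phi x x' -> injective y ->
  (forall j, 0 < evalR I T x (y j)) ->
  exists2 y' : 'I_n -> dom I', injective y' & forall i,
    gmin (fun k => evalR I T x (y k)) <= evalR I' T x' (y' i).
Proof.
move=> NP bT xx' injy T0; have hT := basic_Ltri bT.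
set p := gmin _; have p0 : 0 < p by exact: gmin_pos.
have p1 : p <= 1 by exact: gmin_le1.
have pT i : p <= evalR I T x (y i) by exact: gmin_le.
have hE : Ltri_concept Phi (CGeN n T) by case: hT.
have pE : p <= evalC I (CGeN n T) x.
  apply: (le_sup_ge_set (T := evalR I T) (C := fun=> 1) _ _ (y := y)) => //.
  - by move=> *; exact: evalR_itv hT.
  - by move=> *; rewrite ler01 lexx.
  - by apply: le_gmin => // i; rewrite le_gtnorm pT.
rewrite (indistP xx' hE) in pE.
have [|_ [y' injy' <-] py'] := attained (p := p) (witnessed_geN wI' (x := x') hE).
  by rewrite p0.
have {}py' i := le_trans py' (gmin_le _ i).
by exists y' => // i; move: (py' i); rewrite le_gtnorm => /andP[].
Qed.

End Forth.


(** * Indistinguishability is a crisp bisimulation *)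

Lemma indist_bisimulation (I I' : interp) :
  witnessed (Ltri_role Phi) (Ltri_concept Phi) I ->
  witnessed (Ltri_role Phi) (Ltri_concept Phi) I' ->
  modally_saturated Phi I -> modally_saturated Phi I' ->
  crisp_bisimulation Phi (@indist R CN RN IN Phi I I').
Proof.
move=> wI wI' sI sI'.
have T01 (J : interp) T x y : basic_role Phi T -> 0 <= evalR J T x y <= 1.
  by move=> /basic_Ltri; exact: evalR_itv.
have name0 (J : interp) A (x : dom J) : 0 <= cname A x.
  by case/andP: (cname_itv A x).
have role0 (J : interp) r (x y : dom J) : 0 <= rname r x y.
  by case/andP: (rname_itv r x y).
have ge0 (J : interp) T (b : bool) x y : basic_role Phi T ->
    0 <= gtnorm b%:R (evalR J T x y).
  by move=> bT; rewrite le_gtnorm ler0n; case/andP: (T01 J T x y bT).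
have gt1 (p : R) : 0 <= p <= 1 -> gtnorm true%:R p = p.
  by move=> /andP[_ p1]; apply: min_r.
have gt0 (p : R) : 0 <= p <= 1 -> gtnorm false%:R p = 0.
  by move=> /andP[p0 _]; apply: min_l.
have min01 (J : interp) T n x (y : 'I_n -> dom J) : basic_role Phi T ->
    0 <= gmin (fun k => evalR J T x (y k)) <= 1.
  by move=> bT; apply: gmin_itv => i; case/andP: (T01 J T x (y i) bT).
(* Stated for any two interpretations, so that the back clause follows by exchanging them. *)
have forth (J J' : interp) (w : witnessed (Ltri_role Phi) (Ltri_concept Phi) J')
    (s : modally_saturated Phi J') (x : dom J) (x' : dom J') T y :
    basic_role Phi T -> exists y', gtnorm (indist Phi x x')%:R (evalR J T x y)
      <= gtnorm (indist Phi y y')%:R (evalR J' T x' y').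
  (* If the points are unrelated or the role degree is 0, the left side is 0 and any point serves;
     [x'] is at hand. *)
  move=> bT; have [xx'|_] := boolP (indist Phi x x'); last first.
    by exists x'; rewrite gt0 ?ge0 ?T01.
  have [p0|p0] := ltP 0 (evalR J T x y); last first.
    by exists x'; rewrite gt1 ?T01// (le_trans p0)// ge0.
  have [y' yy' pT] := indist_forth w s bT xx' p0.
  by exists y'; rewrite yy' !gt1 ?T01.
split.
- move=> x x' A; have [xx'|_] := boolP (indist Phi x x'); last exact: giff_ge0.
  by have /= -> := indistP xx' (C := CName A) (conj _ _); rewrite ?giffxx.
- by move=> x x' T bT y; exact: forth.
- move=> x x' T bT y'; have [y] := forth I' I wI sI x' x T y' bT.
  by rewrite !(@indistC _ _ _ _ _ I' I); exists y.
(* The nominal of [a] would have degree 1 at one point and 0 at the other. *)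
- move=> OP x x' a xa; apply/negbTE/negP.
  move=> /indistP/(_ (CNominal a) (conj OP Logic.I)) /=.
  by case: xa => -[xa x'a]; do 2 case: asboolP => // _; move=> /eqP;
    rewrite ?oner_eq0// eq_sym oner_eq0.
- move=> UP x x' y; have [xx'|_] := boolP (indist Phi x x'); last by exists x'.
  by have [y' yy'] := indist_U_forth wI' sI' y UP xx'; exists y'; rewrite yy'.
- move=> UP x x' y'; have [|_] := boolP (indist Phi x x'); last by exists x.
  rewrite indistC => xx'; have [y] := indist_U_forth wI sI y' UP xx'.
  by rewrite indistC => yy'; exists y; rewrite yy'.
- move=> SP x x' r; have [xx'|_] := boolP (indist Phi x x'); last exact: giff_ge0.
  by have /= -> := indistP xx' (C := CSelf r) (conj _ _); rewrite ?giffxx.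
- move=> n QP x x' T y bT; rewrite ltr0n lt0b => xx' injy T0.
  have [y' injy' yy'] := indist_Q_forth wI' sI' QP bT xx' injy T0.
  exists y' => // i; have [pT [j yyj]] := yy' i.
  by exists j; rewrite xx' yyj !gt1 ?T01 ?min01.
- move=> n QP x x' T y' bT; rewrite ltr0n lt0b indistC => xx' injy T0.
  have [y injy' yy'] := indist_Q_forth wI sI QP bT xx' injy T0.
  exists y => // i; have [pT [j]] := yy' i; rewrite indistC => yyj.
  by exists j; rewrite xx' yyj !gt1 ?T01 ?min01.
- move=> n NP x x' T y bT; rewrite ltr0n lt0b => xx' injy T0.
  have [y' injy' yy'] := indist_N_forth wI' NP bT xx' injy T0.
  by exists y' => // i; rewrite xx' gt1 ?min01.
- move=> n NP x x' T y' bT; rewrite ltr0n lt0b indistC => xx' injy T0.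
  have [y injy' yy'] := indist_N_forth wI NP bT xx' injy T0.
  by exists y => // i; rewrite xx' gt1 ?min01.
Qed.

(** Forth and back clauses trade places, so that each equality of degrees below reduces to one
    inequality. *)
Lemma flip_bisimulation (I I' : interp) (Z : dom I -> dom I' -> bool) :
  crisp_bisimulation Phi Z -> crisp_bisimulation Phi (fun x' x => Z x x').
Proof.
case=> nm fo ba no uf ub se qf qb nf nb; split.
- by move=> x' x A; rewrite giffC.
- by move=> x' x; exact: ba.
- by move=> x' x; exact: fo.
- by move=> OP x' x a H; apply: (no OP x x' a); case: H => -[? ?]; [right|left].
- by move=> UP x' x; exact: ub.
- by move=> UP x' x; exact: uf.
- by move=> SP x' x r; rewrite giffC; exact: se.
- by move=> n QP x' x T y' bT; exact: qb.
- by move=> n QP x' x T y bT; exact: qf.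
- by move=> n NP x' x T y' bT; exact: nb.
- by move=> n NP x' x T y bT; exact: nf.
Qed.

(** * Bisimulations preserve the degrees of concepts *)

Section Invariance.
Context (I I' : interp) (Z : dom I -> dom I' -> bool).
Hypothesis bZ : crisp_bisimulation Phi Z.
Implicit Types (T : role) (C : concept).

(** Reduces to the clause for basic roles or to the one for [U]. For a basic role, the positive
    degree on the left forces [Z y y'] to be true. *)
Lemma bisim_role_forth (x : dom I) (x' : dom I') T y : Ltri_role Phi T ->
  Z x x' -> 0 < evalR I T x y ->
  exists2 y', Z y y' & evalR I T x y <= evalR I' T x' y'.
Proof.
move=> hT xx' T0; have [_ T1] := andP (evalR_itv x y hT).
case: (Ltri_roleP hT) => [[T' bT TE]|[UP TE]]; last first.
  have [y'] := bisim_U_forth bZ UP x x' y; rewrite xx' ler_nat => yy'.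
  by exists y'; [move: yy'; case: (Z y y')|rewrite !TE].
have [y'] := bisim_forth bZ x x' bT y; rewrite xx' -!TE {1}/gtnorm min_r//.
rewrite le_gtnorm => /andP[yy' TT']; exists y' => //.
by have := lt_le_trans T0 yy'; rewrite ltr0n lt0b.
Qed.

(** A successor [y] contributing a positive degree is matched by some [y'] with at least the same
    role degree and an equal concept degree. *)
Lemma bisim_exists_le (x : dom I) (x' : dom I') T C : Ltri_role Phi T ->
  Ltri_concept Phi C -> Z x x' ->
  (forall y y', Z y y' -> evalC I C y = evalC I' C y') ->
  evalC I (CExists T C) x <= evalC I' (CExists T C) x'.
Proof.
move=> hT hC xx' IH.
have T01 (J : interp) y z := @evalR_itv _ _ _ _ _ J T y z hT.
have C01 (J : interp) y := @evalC_itv _ _ _ _ _ J C y hC.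
apply: (@le_sup01 _ (exists_set (evalR I T) (evalC I C) x)
  (exists_set (evalR I' T) (evalC I' C) x')) => [v|v|_ [y _ <-]].
- by move=> /(exists_set_itv (T01 I) (C01 I)).
- by move=> /(exists_set_itv (T01 I') (C01 I')).
rewrite lt_min => /andP[T0 C0].
have [y' yy' TT'] := bisim_role_forth hT xx' T0.
exists (gtnorm (evalR I' T x' y') (evalC I' C y')); first by exists y'.
by rewrite (IH _ _ yy') le_gtnorm !ge_min TT' lexx orbT.
Qed.

(** Let [m] be the degree contributed by the family [y]. Each [y' i] has role degree at least the
    minimum over all [y k], hence at least [m], and shares its degree of [C] with some [y j], where
    that degree is at least [m]. *)
Lemma bisim_ge_le (x : dom I) (x' : dom I') n T C : Phi (FQ n) ->
  basic_role Phi T -> Ltri_concept Phi C -> Z x x' ->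
  (forall y y', Z y y' -> evalC I C y = evalC I' C y') ->
  evalC I (CGe n T C) x <= evalC I' (CGe n T C) x'.
Proof.
move=> QP bT hC xx' IH; have hT := basic_Ltri bT.
have T01 (J : interp) y z := @evalR_itv _ _ _ _ _ J T y z hT.
have C01 (J : interp) y := @evalC_itv _ _ _ _ _ J C y hC.
apply: (@le_sup01 _ (ge_set n (evalR I T) (evalC I C) x)
  (ge_set n (evalR I' T) (evalC I' C) x')) => [v|v|_ [y injy <-] v0].
- by move=> /(ge_set_itv (T01 I) (C01 I)).
- by move=> /(ge_set_itv (T01 I') (C01 I')).
have T0 j : 0 < evalR I T x (y j).
  by have := gmin_gt0 v0 j; rewrite lt_min => /andP[].
have Z0 : 0 < (Z x x')%:R :> R by rewrite xx' ltr01.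
have [y' injy' yy'] := bisim_Q_forth bZ QP bT Z0 injy T0.
eexists; first by exists y'.
set m := gmin _; have m1 : m <= 1 by exact: gmin_le1.
have mTC k := gmin_le (fun k => gtnorm (evalR I T x (y k)) (evalC I C (y k))) k.
have mT : m <= gmin (fun k => evalR I T x (y k)).
  by apply: le_gmin => // k; have := mTC k; rewrite le_gtnorm => /andP[].
apply: le_gmin => // i; have [j] := yy' i.
rewrite xx' {1}/gtnorm min_r ?gmin_le1//.
rewrite le_gtnorm => /andP[Zji TT'].
(* Positivity of [m] turns the inequality on truth values into an actual pair of [Z]. *)
have {}Zji : Z (y j) (y' i).
  by have := lt_le_trans (lt_le_trans v0 mT) Zji; rewrite ltr0n lt0b.
rewrite le_gtnorm (le_trans mT TT') -(IH _ _ Zji).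
by have := mTC j; rewrite le_gtnorm => /andP[].
Qed.

Lemma bisim_geN_le (x : dom I) (x' : dom I') n T : Phi (FN n) ->
  basic_role Phi T -> Z x x' ->
  evalC I (CGeN n T) x <= evalC I' (CGeN n T) x'.
Proof.
move=> NP bT xx'; have hT := basic_Ltri bT.
have T01 (J : interp) y z := @evalR_itv _ _ _ _ _ J T y z hT.
have C01 (J : interp) (y : dom J) : 0 <= (1 : R) <= 1 by rewrite ler01 lexx.
apply: (@le_sup01 _ (ge_set n (evalR I T) (fun=> 1) x)
  (ge_set n (evalR I' T) (fun=> 1) x')) => [v|v|_ [y injy <-] v0].
- by move=> /(ge_set_itv (T01 I) (C01 I)).
- by move=> /(ge_set_itv (T01 I') (C01 I')).
have T0 j : 0 < evalR I T x (y j).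
  by have := gmin_gt0 v0 j; rewrite lt_min => /andP[].
have Z0 : 0 < (Z x x')%:R :> R by rewrite xx' ltr01.
have [y' injy' yy'] := bisim_N_forth bZ NP bT Z0 injy T0.
eexists; first by exists y'.
set m := gmin _; have m1 : m <= 1 by exact: gmin_le1.
have mTC k := gmin_le (fun k => gtnorm (evalR I T x (y k)) 1) k.
have mT : m <= gmin (fun k => evalR I T x (y k)).
  by apply: le_gmin => // k; have := mTC k; rewrite le_gtnorm => /andP[].
apply: le_gmin => // i; rewrite le_gtnorm m1 andbT.
by apply: le_trans (yy' i); rewrite xx' le_gtnorm m1.
Qed.

End Invariance.

Lemma bisim_indist (I I' : interp) (Z : dom I -> dom I' -> bool) x x' :
  crisp_bisimulation Phi Z -> Z x x' -> indist Phi x x'.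
Proof.
move=> bZ xx'; apply/asboolP => C hC.
have bZ' := flip_bisimulation bZ.
(* The points are generalized, since the modal cases use the induction hypothesis at successors. *)
move: C hC x x' xx'; apply: Ltri_ind => //.
- move=> A x x' xx'; have := bisim_name bZ x x' A; rewrite xx'.
  by apply: giff_ge1; [case/andP: (cname_itv A x)|case/andP: (cname_itv A x')].
- by move=> C D IC ID x x' xx' /=; rewrite (IC _ _ xx') (ID _ _ xx').
- by move=> C D IC ID x x' xx' /=; rewrite (IC _ _ xx') (ID _ _ xx').
- by move=> C IC x x' xx' /=; rewrite (IC _ _ xx').
(* One inequality comes from [Z], the other from the flipped relation. *)
- move=> T C hT hC IC x x' xx'; apply/eqP; rewrite eq_le.
  rewrite (bisim_exists_le bZ)//= (bisim_exists_le bZ')// => y' y yy'.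
  by rewrite (IC _ _ yy').
- move=> a OP x x' xx' /=; case: asboolP => xa; case: asboolP => // x'a.
    by have := bisim_O bZ OP (or_introl (conj xa x'a)); rewrite xx'.
  by have := bisim_O bZ OP (or_intror (conj xa x'a)); rewrite xx'.
- move=> r SP x x' xx'; have := bisim_Self bZ SP x x' r; rewrite xx'.
  by apply: giff_ge1; [case/andP: (rname_itv r x x)|case/andP: (rname_itv r x' x')].
- move=> n T C QP bT hC IC x x' xx'; apply/eqP; rewrite eq_le.
  rewrite (bisim_ge_le bZ)//= (bisim_ge_le bZ')// => y' y yy'.
  by rewrite (IC _ _ yy').
- move=> n T NP bT x x' xx'; apply/eqP; rewrite eq_le.
  by rewrite (bisim_geN_le bZ)//= (bisim_geN_le bZ').
Qed.

End Hennessy_Milner.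

Theorem theorem9 (R : realType) (CN RN IN : Type) (Phi : set feature)
    (I I' : interp R CN RN IN)
    (hPhi : Phi `<=` features)
    (wI : witnessed (Ltri_role Phi) (Ltri_concept Phi) I)
    (wI' : witnessed (Ltri_role Phi) (Ltri_concept Phi) I')
    (sI : modally_saturated Phi I)
    (sI' : modally_saturated Phi I') :
  crisp_bisimulation Phi (@indist R CN RN IN Phi I I') /\
  forall Z' : dom I -> dom I' -> bool, crisp_bisimulation Phi Z' ->
    forall (x : dom I) (x' : dom I'),
      (Z' x x')%:R <= (indist Phi x x')%:R :> R.
Proof.
split=> [|Z' bZ x x']; first exact: indist_bisimulation.
by rewrite ler_nat; case: (boolP (Z' x x')) => // /(bisim_indist bZ) ->.
Qed.
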